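(* Let $K$ be a $b$-complete idempotent semiring, $X$ a nonempty set, and $V\subset K(X)$ a functional $b$-semimodule. The kernel theorem holds for $V$ if and only if the identity operator $\mathrm{id}:V\to V$ is integral.
   Context: An idempotent semigroup is a commutative semigroup $(S,\oplus)$ with $x\oplus x=x$ for all $x$. It carries the standard order $x\preceq y \iff x\oplus y=y$, so $x\oplus y=\sup\{x,y\}$; write $\oplus X=\sup X$ when it exists. ''Bounded'' means bounded from above. $S$ is $b$-complete if every bounded subset, including $\varnothing$, has a least upper bound; then $\mathbf 0=\oplus\varnothing$ is the zero (least) element. An idempotent semiring $K$ is an idempotent semigroup with an associative (not necessarily commutative) multiplication $\odot$ with identity $\mathbf 1$ and both distributive laws; it is $b$-complete if it is a $b$-complete semigroup and $k\odot(\oplus Q)=\oplus(k\odot Q)$, $(\oplus Q)\odot k=\oplus(Q\odot k)$ for all $k\in K$ and bounded $Q\subset K$. A (left, idempotent) semimodule $V$ over $K$ is an idempotent semigroup with zero $\mathbf 0$ and a multiplication $k\odot x$ ($k\in K$, $x\in V$) with $a\odot(b\odot x)=(a\odot b)\odot x$, $(a\oplus b)\odot x=a\odot x\oplus b\odot x$, $a\odot(x\oplus y)=a\odot x\oplus a\odot y$, $\mathbf 0\odot x=\mathbf 0$, $\mathbf 1\odot x=x$. $V$ (over $b$-complete $K$) is $b$-complete if it is a $b$-complete semigroup and $k\odot\oplus S=\oplus(k\odot S)$, $(\oplus Q)\odot v=\oplus(Q\odot v)$ for all $k\in K$, $v\in V$ and bounded $S\subset V$, $Q\subset K$. A homomorphism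 $g:V\to W$ of $b$-complete semimodules (additive, $g(a\odot x)=a\odot g(x)$) is $b$-linear if $g(\oplus S)=\oplus g(S)$ for every bounded $S\subset V$. $K(X)$ is the semimodule of all functions $X\to K$ with pointwise operations. A functional $b$-semimodule on $X$ is a $b$-subsemimodule $V$ of $K(X)$: a subsemimodule (closed under pointwise addition and scalar multiplication) that is itself $b$-complete and whose inclusion is $b$-linear, i.e. suprema in $V$ of subsets bounded in $V$ are the pointwise suprema. A mapping $A:V\to W$ into a $b$-complete semimodule $W$ has an integral representation (is integral) if there is a mapping $k:X\to W$ such that for every $f\in V$ the set $\{f(x)\odot k(x)\mid x\in X\}$ is bounded in $W$ and $Af=\bigoplus_{x\in X}f(x)\odot k(x)$. The kernel theorem holds for $V$ if for every $b$-complete semimodule $W$ over $K$, every $b$-linear mapping $V\to W$ has an integral representation. *)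

(* Defs.v *)
From HB Require Import structures.
From mathcomp Require Import all_boot all_algebra.
From mathcomp Require Import boolp classical_sets functions.
Set Implicit Arguments.
Unset Strict Implicit.
Unset Printing Implicit Defensive.
Import GRing.Theory.
Local Open Scope ring_scope.
Local Open Scope classical_set_scope.

(* The idempotent addition is the [+] of an [nmodType], the zero element is   *)
(* its [0]; semirings are [pzSemiRingType]s (multiplication not necessarily   *)
(* commutative, [0 = 1] not excluded), left semimodules are [lSemiModType]s   *)
(* and homomorphisms of semimodules are [{linear V -> W}].                    *)

Section IdempotentSemigroup.
Context (M : nmodType).
Implicit Types (x y s : M) (S : set M).

Definition std_le x y : Prop := x + y = y.

Definition upper_bound S y : Prop := forall x, S x -> std_le x y.

Definition bounded S : Prop := exists y, upper_bound S y.

(* [is_sup S s] reads "the sup of S exists and equals s". *)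
Definition is_sup S s : Prop :=
  upper_bound S s /\ forall y, upper_bound S y -> std_le s y.

Definition idempotent_semigroup : Prop := idempotent_op (@GRing.add M).

Definition bcomplete_semigroup : Prop :=
  idempotent_semigroup /\ forall S, bounded S -> exists s, is_sup S s.

End IdempotentSemigroup.

(* When [M] is a b-complete semigroup, a set has a sup iff it is bounded, and *)
(* this says that [g] maps the sup of each bounded set to the sup of its      *)
(* image.                                                                     *)
Definition preserves_sups (M N : nmodType) (g : M -> N) : Prop :=
  forall (S : set M) (s : M), bounded S -> is_sup S s -> is_sup (g @` S) (g s).

Definition bcomplete_semiring (K : pzSemiRingType) : Prop :=
  [/\ bcomplete_semigroup K,
      forall k : K, preserves_sups (fun q : K => k * q) &
      forall k : K, preserves_sups (fun q : K => q * k)].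

Definition bcomplete_semimodule (K : pzSemiRingType) (V : lSemiModType K) :
    Prop :=
  [/\ bcomplete_semigroup V,
      forall k : K, preserves_sups (fun v : V => k *: v) &
      forall v : V, preserves_sups (fun q : K => q *: v)].

Definition b_linear (K : pzSemiRingType) (V W : lSemiModType K)
    (g : {linear V -> W}) : Prop :=
  preserves_sups g.

(* The semimodule K(X). The function spaces of the library are modules only   *)
(* over rings, so the pointwise scalar multiplication is added here.          *)
Definition fun_semimod (K : pzSemiRingType) (X : Type) : Type := X -> K.

Section FunSemimod.
Context (K : pzSemiRingType) (X : Type).
Local Notation KX := (fun_semimod K X).

HB.instance Definition _ := GRing.Nmodule.copy KX (X -> K).

Definition fun_scale (a : K) (f : KX) : KX := fun x => a * f x.

Let fun_scalerA a b f : fun_scale a (fun_scale b f) = fun_scale (a * b) f.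
Proof. by apply/funext => x; rewrite /fun_scale mulrA. Qed.

Let fun_scale0r f : fun_scale 0 f = 0.
Proof. by apply/funext => x; rewrite /fun_scale mul0r. Qed.

Let fun_scale1r : left_id 1 fun_scale.
Proof. by move=> f; apply/funext => x; rewrite /fun_scale mul1r. Qed.

Let fun_scalerDr : right_distributive fun_scale +%R.
Proof. by move=> a f g; apply/funext => x; rewrite /fun_scale mulrDr. Qed.

Let fun_scalerDl f : {morph fun_scale^~ f : a b / a + b}.
Proof. by move=> a b; apply/funext => x; rewrite /fun_scale mulrDl. Qed.

HB.instance Definition _ := GRing.Nmodule_isLSemiModule.Build K KX
  fun_scalerA fun_scale0r fun_scale1r fun_scalerDr fun_scalerDl.

End FunSemimod.

(* A subset [V : submodClosed M] (containing 0, closed under addition and     *)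
(* scalar multiplication), viewed as a semimodule with the operations of [M]. *)
Section SubSemimod.
Context (K : pzSemiRingType) (M : lSemiModType K) (V : submodClosed M).

Record sub_semimod : Type :=
  SubSemimod { sub_semimod_val :> M; _ : sub_semimod_val \in V }.

HB.instance Definition _ := [isSub for sub_semimod_val].
HB.instance Definition _ := [Choice of sub_semimod by <:].
HB.instance Definition _ := [SubChoice_isSubLSemiModule of sub_semimod by <:].

Definition sub_semimod_inclusion : {linear sub_semimod -> M} :=
  (val : sub_semimod -> M).

End SubSemimod.

Section KernelTheorem.
Context (K : pzSemiRingType) (X : Type) (V : submodClosed (fun_semimod K X)).

Definition functional_bsemimodule : Prop :=
  bcomplete_semimodule (sub_semimod V) /\ b_linear (sub_semimod_inclusion V).

Definition is_integral (W : lSemiModType K) (A : sub_semimod V -> W) : Prop :=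
  exists k : X -> W, forall f : sub_semimod V,
    bounded [set val f x *: k x | x in [set: X]] /\
    is_sup [set val f x *: k x | x in [set: X]] (A f).

Definition kernel_theorem_holds : Prop :=
  forall W : lSemiModType K, bcomplete_semimodule W ->
  forall A : {linear sub_semimod V -> W}, b_linear A -> is_integral A.

End KernelTheorem.

(* Main.v *)
Require Import Defs.
From mathcomp Require Import all_boot all_algebra.
From mathcomp Require Import classical_sets.

(* If [k] is a kernel of the identity, then [A \o k] is a kernel of every     *)
(* b-linear [A]; conversely the identity of [V] is itself b-linear.           *)

(** Integrality of the identity expands each [f] as the supremum of the [f x *: k x]. A b-linear [A]
    commutes with bounded suprema and with scalars, so [A f] is the supremum of the
    [f x *: A (k x)]; this is [is_integral_comp]. *)

Lemma is_sup_bounded (M : nmodType) (S : set M) (s : M) :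
  is_sup S s -> bounded S.
Proof. by case=> ub_s _; exists s. Qed.

Lemma preserves_sups_id (M : nmodType) : preserves_sups (idfun : M -> M).
Proof. by move=> S s _; rewrite image_id. Qed.

Lemma is_integral_comp (K : pzSemiRingType) (X : Type)
    (V : submodClosed (fun_semimod K X)) (W : lSemiModType K)
    (A : {linear sub_semimod V -> W}) :
  b_linear A -> is_integral (idfun : sub_semimod V -> sub_semimod V) ->
  is_integral A.
Proof.
move=> A_blin [k k_int]; exists (A \o k) => f.
(* Boundedness comes for free, a supremum being an upper bound. *)
suff sup_Af : is_sup (image setT (fun x => val f x *: (A \o k) x)%R) (A f).
  by split; first exact: is_sup_bounded sup_Af.
have [bdd_f sup_f] := k_int f.
have := A_blin _ _ bdd_f sup_f; rewrite image_comp.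
by under eq_imagel => x _ do rewrite /= GRing.linearZ.
Qed.

Theorem mainTheorem4 (K : pzSemiRingType) (K_bcomplete : bcomplete_semiring K)
    (X : Type) (X_nonempty : inhabited X)
    (V : submodClosed (fun_semimod K X)) (V_functional : functional_bsemimodule V) :
  kernel_theorem_holds V <->
  is_integral (idfun : sub_semimod V -> sub_semimod V).
Proof.
have [V_bcomplete _] := V_functional; split=> [kernelV | id_int W _ A A_blin].
  (* The target [W] is [V] itself, which is b-complete because it is a functional b-semimodule. *)
  exact: (kernelV _ V_bcomplete idfun (@preserves_sups_id _)).
exact: is_integral_comp.
Qed.
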